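(* Let $f:\mathbb{R}^{m_1}\times \mathbb{R}^{m_2}\rightarrow \mathbb{R}$ be a $C^1$ function of the form $f(x,y)=f_1(x)+f_2(y)$, with $f_1:\mathbb{R}^{m_1}\to\mathbb{R}$ and $f_2:\mathbb{R}^{m_2}\to\mathbb{R}$. Fix $0<\alpha,\beta<1$ and $\delta_0>0$. For an arbitrary initial point $z_0=(x_0,y_0)\in \mathbb{R}^{m_1}\times \mathbb{R}^{m_2}$, let $\{z_n\}=\{(x_n,y_n)\}$ be the sequence produced by Coordinate-wise Backtracking GD with parameters $\alpha,\beta,\delta_0$. Then: 1) Any cluster point of $\{z_n\}$ is a critical point of $f$. 2) Either $\lim_{n\to\infty}\|z_n\|=\infty$ or $\lim_{n\to\infty}\|z_{n+1}-z_n\|=0$. 3) If $f$ has at most countably many critical points, then either $\{z_n\}$ converges to a point $z_\infty$ with $\nabla f(z_\infty)=0$, or $\lim_{n\to\infty}\|z_n\|=\infty$. 4) If every connected component of the set of critical points of $f$ is compact, then the set of cluster points of $\{z_n\}$ is connected.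
   Context: Norms are Euclidean. A critical point of a $C^1$ function is a point where its gradient vanishes. A cluster point of a sequence is the limit of some subsequence (in the Euclidean space, so finite). The empty set is regarded as connected. Backtracking step size: given a $C^1$ function $h:\mathbb{R}^m\to\mathbb{R}$, numbers $0<\alpha,\beta<1$ and $\delta_0>0$, and a point $w\in\mathbb{R}^m$, the step size of $h$ at $w$ is the largest number $\delta$ in $\{\beta^n\delta_0: n=0,1,2,\ldots\}$ satisfying Armijo's condition $$h(w-\delta\nabla h(w))-h(w)\le -\alpha\,\delta\,\|\nabla h(w)\|^2 .$$ Coordinate-wise Backtracking GD: for $f(x,y)=f_1(x)+f_2(y)$, let $\delta_1(x)$ be the backtracking step size of $f_1$ at $x$ and $\delta_2(y)$ the backtracking step size of $f_2$ at $y$ (with the same $\alpha,\beta,\delta_0$). Starting from $z_0=(x_0,y_0)$, define inductively $$z_{n+1}=(x_{n+1},y_{n+1})=\big(x_n-\delta_1(x_n)\nabla f_1(x_n),\; y_n-\delta_2(y_n)\nabla f_2(y_n)\big).$$ *)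

(* Defs.v *)
From HB Require Import structures.
From mathcomp Require Import all_boot all_order all_algebra.
From mathcomp Require Import all_classical all_reals all_analysis.

Set Implicit Arguments.
Unset Strict Implicit.
Unset Printing Implicit Defensive.

Import Order.TTheory GRing.Theory Num.Theory.
Import numFieldNormedType.Exports.

Local Open Scope classical_set_scope.
Local Open Scope ring_scope.

(* The library norm on 'rV[R]_m is the sup norm, which induces the Euclidean
   topology; the Euclidean norm itself has to be defined. *)
Definition enorm (R : realType) (m : nat) (v : 'rV[R]_m) : R :=
  Num.sqrt (\sum_(i < m) v 0 i ^+ 2).

Definition gradient (R : realType) (m : nat) (h : 'rV[R]_m -> R)
    (w : 'rV[R]_m) : 'rV[R]_m :=
  \row_(i < m) 'D_(delta_mx 0 i) h w.

Definition C1 (R : realType) (m : nat) (h : 'rV[R]_m -> R) : Prop :=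
  (forall w, differentiable h w) /\ continuous (gradient h).

Definition critical_points (R : realType) (m : nat) (h : 'rV[R]_m -> R) :
    set 'rV[R]_m :=
  [set w | gradient h w = 0].

Definition cluster_points (R : realType) (m : nat) (z : nat -> 'rV[R]_m) :
    set 'rV[R]_m :=
  [set p | exists2 s : nat -> nat, increasing_seq s & (z \o s) @ \oo --> p].

Definition armijo (R : realType) (m : nat) (alpha : R) (h : 'rV[R]_m -> R)
    (w : 'rV[R]_m) (delta : R) : Prop :=
  h (w - delta *: gradient h w) - h w
    <= - alpha * delta * enorm (gradient h w) ^+ 2.

Definition armijo_steps (R : realType) (m : nat) (alpha beta delta0 : R)
    (h : 'rV[R]_m -> R) (w : 'rV[R]_m) : set R :=
  [set delta | (exists n : nat, delta = beta ^+ n * delta0) /\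
               armijo alpha h w delta].

(* The largest element of armijo_steps. It exists whenever h is C1,
   0 < alpha, beta < 1 and 0 < delta0; the default value 0 is then not used. *)
Definition backtracking_step (R : realType) (m : nat) (alpha beta delta0 : R)
    (h : 'rV[R]_m -> R) (w : 'rV[R]_m) : R :=
  xget 0 (armijo_steps alpha beta delta0 h w `&`
          ubound (armijo_steps alpha beta delta0 h w)).

Definition backtracking_update (R : realType) (m : nat)
    (alpha beta delta0 : R) (h : 'rV[R]_m -> R) (w : 'rV[R]_m) : 'rV[R]_m :=
  w - backtracking_step alpha beta delta0 h w *: gradient h w.

(* R^m1 x R^m2 is identified with R^(m1 + m2), the pair (x, y) being
   row_mx x y. *)
Definition coordwise_backtracking_GD (R : realType) (m1 m2 : nat)
    (alpha beta delta0 : R) (f1 : 'rV[R]_m1 -> R) (f2 : 'rV[R]_m2 -> R)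
    (x0 : 'rV[R]_m1) (y0 : 'rV[R]_m2) (n : nat) : 'rV[R]_(m1 + m2) :=
  row_mx (iter n (backtracking_update alpha beta delta0 f1) x0)
         (iter n (backtracking_update alpha beta delta0 f2) y0).

(* Main.v *)
(* Each coordinate is an ordinary backtracking descent. If a subsequence of it
   converges, its values converge, so the decrements delta_n |grad|^2 tend to 0;
   as delta_n <= delta0, the increments tend to 0, and as delta_n is bounded
   below near a noncritical point, the limit is critical. When z_n does not
   tend to infinity, both coordinates have a common convergent subsequence, so
   all increments of z_n tend to 0.  Pieces of the orbit are then asymptotically
   finely chained, and the limit set of a family of such pieces starting near a
   common cluster point is connected. If the component of a cluster point in
   the critical set is compact, long excursions of the orbit would yield a
   connected set of critical points leaving that component; hence the orbit is
   bounded and its whole cluster set is connected. A countable critical set has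
   singleton components, so the orbit then has a single cluster point. *)

Require Import Defs.
From mathcomp Require Import all_boot all_order all_algebra.
From mathcomp Require Import all_classical all_reals all_analysis.
From mathcomp Require Import lra.

Set Implicit Arguments.
Unset Strict Implicit.
Unset Printing Implicit Defensive.

Import Order.TTheory GRing.Theory Num.Theory.
Import numFieldNormedType.Exports.

Local Open Scope classical_set_scope.
Local Open Scope ring_scope.

(** * Cluster points of sequences *)

(** Quantifier form of being a subsequential limit: it passes through continuous maps and
    reindexings without handling subsequences. *)
Definition frequently_near (R : realType) (V : normedModType R)
    (u : nat -> V) : set V :=
  [set p | forall e : R, 0 < e ->
    forall N, exists2 n, (N <= n)%N & `|u n - p| < e].

Lemma increasing_seq_geq (s : nat -> nat) : increasing_seq s ->
  forall n, (n <= s n)%N.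
Proof.
move=> /increasing_seqP s_lt; elim=> // n /leq_ltn_trans; apply.
exact: s_lt.
Qed.

(** If [p] is frequently near, then the real sequence [|u n - p|] clusters at 0, and a subsequence
    along which it tends to 0 is the one sought. *)
Lemma frequently_nearP (R : realType) (V : normedModType R) (u : nat -> V) p :
  frequently_near u p <->
  exists2 s : nat -> nat, increasing_seq s & (u \o s) @ \oo --> p.
Proof.
split=> [up|[s s_incr /cvgrPdist_lt usp] e e0 N]; last first.
  have [N1 _ uN1] := usp e e0.
  exists (s (maxn N N1)).
    by rewrite (leq_trans (leq_maxl N N1))// increasing_seq_geq.
  by rewrite distrC; apply: uN1; exact: leq_maxr.
have [s s_incr s0] : exists2 s : nat -> nat, increasing_seq s &
    ((fun n => `|u n - p|) \o s) @ \oo --> (0 : R).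
  apply/cluster_eventually_cvg/cluster_eventuallyP => e N e0.
  have [n Nn une] := up e e0 N.
  by exists n => //=; rewrite sub0r normrN normr_id ltW.
exists s => //; apply/subr_cvg0/norm_cvg0P.
by move: s0; congr (_ @ _ --> _).
Qed.

(** Bolzano-Weierstrass, from compactness of closed balls in finite dimension. *)
Lemma bounded_frequently_near (R : realType) m (u : nat -> 'rV[R]_m) (M : R) :
  (forall n, `|u n| <= M) -> exists p, frequently_near u p.
Proof.
move=> uM.
have cA : compact [set v : 'rV[R]_m | `|v| <= M].
  apply: bounded_closed_compact.
    exists M; split; first exact: num_real.
    by move=> x Mx v /= /le_trans -> //; exact: ltW.
  rewrite (_ : [set v | _] = (fun v => `|v|) @^-1` [set x | x <= M]) //.
  by apply: (preimage_closed _ (@closed_le _ _)) => v _; exact: norm_continuous.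
have [|p [_ clp]] := cA (u @ \oo) _.
  by exists 0%N => // n _; exact: uM.
exists p => e e0 N.
have /(_ (u @` [set n | (N <= n)%N]) (ball p e)) := clp.
case; first by exists N => // n Nn; exists n.
  exact: nbhsx_ballx.
move=> _ [[n Nn <-]]; rewrite -ball_normE /= => une.
by exists n => //; rewrite distrC.
Qed.

(** Without a gap, points of [A] and [B] at distance below 1/(n+1) would accumulate at a common
    point; it lies in the closed union, hence in one set and in the closure of the other. *)
Lemma separated_gap (R : realType) m (A B : set 'rV[R]_m) (M : R) :
  closed (A `|` B) -> (forall v, (A `|` B) v -> `|v| <= M) ->
  separated A B ->
  exists2 e : R, 0 < e & forall a b, A a -> B b -> e <= `|a - b|.
Proof.
move=> clAB bnd [cAB AcB]; apply: contrapT => nogap.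
have near_pair (n : nat) : exists ab : 'rV[R]_m * 'rV[R]_m,
    [/\ A ab.1, B ab.2 & `|ab.1 - ab.2| < n.+1%:R^-1].
  apply: contrapT => no; apply: nogap.
  exists n.+1%:R^-1; first by rewrite invr_gt0.
  move=> a b Aa Bb; rewrite leNgt; apply/negP => ab.
  by apply: no; exists (a, b).
have [ab ab_near] := choice near_pair.
have [|p pa] := @bounded_frequently_near _ _ (fun n => (ab n).1) M.
  by move=> n; apply: bnd; left; case: (ab_near n).
have cA : closure A p.
  move=> U /nbhs_ballP[e /= e0 eU]; have [n _ ne] := pa e e0 0%N.
  exists (ab n).1; split; first by case: (ab_near n).
  by apply: eU; rewrite -ball_normE /= distrC.
have cB : closure B p.
  move=> U /nbhs_ballP[e /= e0 eU].
  have e20 : 0 < e / 2 by rewrite divr_gt0.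
  have [N _ Ne] := near_infty_natSinv_lt (PosNum e20).
  have [n Nn ne] := pa _ e20 N.
  exists (ab n).2; split; first by case: (ab_near n).
  apply: eU; rewrite -ball_normE /=.
  have -> : p - (ab n).2 = - ((ab n).1 - p) + ((ab n).1 - (ab n).2).
    by rewrite opprB -addrA addKr.
  rewrite (le_lt_trans (ler_normD _ _))// normrN [e]splitr ltrD//.
  by case: (ab_near n) => _ _ /lt_trans; apply; exact: Ne.
have : (A `|` B) p.
  rewrite (closure_id (A `|` B)).1//; apply: closureS cA.
  exact: subsetUl.
case=> [Ap|Bp].
  by have : (A `&` closure B) p by []; rewrite AcB.
by have : (closure A `&` B) p by []; rewrite cAB.
Qed.

(** * Connectedness of limit sets and boundedness of the orbit *)

(** The Kuratowski upper limit, as [k] grows, of the images under [z] of the index sets [I k]. *)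
Definition seg_limits (R : realType) (V : normedModType R)
    (z : nat -> V) (I : nat -> set nat) : set V :=
  [set p | forall e : R, 0 < e -> forall N,
    exists k n, [/\ (N <= k)%N, I k n & `|z n - p| < e]].

Lemma closed_seg_limits (R : realType) (V : normedModType R)
  (z : nat -> V) (I : nat -> set nat) : closed (seg_limits z I).
Proof.
move=> p clp e e0 N.
have e20 : 0 < e / 2 by rewrite divr_gt0.
have [q [Lq]] := clp _ (nbhsx_ballx p _ e20).
rewrite -ball_normE /= => pq.
have [k [n [Nk Ikn znq]]] := Lq _ e20 N.
exists k, n; split => //.
rewrite -(subrKA q) (le_lt_trans (ler_normD _ _))// [e]splitr ltrD//.
by rewrite distrC.
Qed.

(* Kuratowski's theorem on upper limits of connected sets, in the discrete
   setting: the segments become finely chained as [k] grows, and their initial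
   points converge. *)
Lemma connected_seg_limits (R : realType) m (z : nat -> 'rV[R]_m)
    (I : nat -> set nat) (s : nat -> nat) (w : 'rV[R]_m) (M : R) :
  `|z n.+1 - z n| @[n --> \oo] --> 0 ->
  (forall k, (k <= s k)%N) -> (forall k, I k (s k)) ->
  (forall k n, I k n -> (s k <= n)%N) ->
  (forall k n j, I k n -> (s k <= j <= n)%N -> I k j) ->
  (z \o s) @ \oo --> w ->
  (forall k n, I k n -> `|z n| <= M) ->
  connected (seg_limits z I).
Proof.
move=> step s_ge Is I_ge I_down zsw IM.
have {}step (e : R) : 0 < e -> exists N, forall n, (N <= n)%N ->
    `|z n.+1 - z n| < e.
  move=> e0; move/cvgrPdist_lt : step => /(_ e e0)[N _ HN].
  by exists N => n /HN /=; rewrite sub0r normrN normr_id.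
have {}zsw (e : R) : 0 < e -> exists N, forall k, (N <= k)%N ->
    `|z (s k) - w| < e.
  move=> e0; move/cvgrPdist_lt : zsw => /(_ e e0)[N _ HN].
  by exists N => n /HN /=; rewrite distrC.
have Lw : seg_limits z I w.
  move=> e e0 N; have [N1 HN1] := zsw e e0.
  exists (maxn N N1), (s (maxn N N1)); split => //; first exact: leq_maxl.
  by apply: HN1; exact: leq_maxr.
have LM p : seg_limits z I p -> `|p| <= M.
  move=> Lp; apply/ler_addgt0Pr => e e0; have [k [n [_ Ikn znp]]] := Lp e e0 0%N.
  rewrite -[p](subrK (z n)) (le_trans (ler_normD _ _))// addrC lerD ?(IM k n)//.
  by rewrite distrC ltW.
apply/connectedP => E [E0 LE sE].
(* Up to swapping the two pieces, [w] lies in [E false], so late segments start close to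
   [E false]. *)
wlog Ew : E E0 LE sE / E false w.
  move=> wlg; move: (Lw); rewrite LE => -[|Etw]; first exact: wlg.
  apply: (wlg (E \o negb)) => //=; first by rewrite LE setUC.
  by rewrite separatedC.
have [b Eb] := E0 true.
have [e e0 gap] : exists2 e : R, 0 < e &
    forall a b, E false a -> E true b -> e <= `|a - b|.
  apply: (@separated_gap _ _ _ _ M) => //.
    by rewrite -LE; exact: closed_seg_limits.
  by move=> v; rewrite -LE; exact: LM.
have e30 : 0 < e / 3 by rewrite divr_gt0.
pose close v := exists2 a, E false a & `|v - a| < e / 3.
have [N1 HN1] := step _ e30.
have [N2 HN2] := zsw _ e30.
(* The first index at which the k-th segment leaves the e/3-neighbourhood of
   [E false] gives a point at distance between e/3 and 2e/3 from it. *)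
have crossing (N : nat) : exists kn : nat * nat, [/\ (N <= kn.1)%N, I kn.1 kn.2,
    ~ close (z kn.2) & exists2 a, E false a & `|z kn.2 - a| < e / 3 + e / 3].
  (* Some late segment comes near [b], where the gap [e] keeps it away from [E false], although it
     starts near [w]. *)
  have Lb : seg_limits z I b by rewrite LE; right.
  have [k [n [Nk Ikn znb]]] := Lb _ e30 (maxn N (maxn N1 N2)).
  move: Nk; rewrite !geq_max => /and3P[Nk N1k N2k].
  have far_n : ~ close (z n).
    case=> a Ea zna; have := gap _ _ Ea Eb; apply/negP; rewrite -ltNge.
    rewrite -(subrKA (z n)) (le_lt_trans (ler_normD _ _))//.
    by rewrite -normrN opprB; lra.
  have close_s : close (z (s k)) by exists w => //; exact: HN2.
  have ex_far : exists n, `[< (s k <= n)%N /\ ~ close (z n) >].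
    by exists n; apply/asboolP; split => //; exact: I_ge.
  case: (ex_minnP ex_far) => j /asboolP[skj far_j] j_min.
  have jn : (j <= n)%N by apply: j_min; apply/asboolP; split => //; exact: I_ge.
  exists (k, j) => /=; split => //; first by apply: I_down Ikn _; rewrite skj.
  have skj' : (s k < j)%N.
    by rewrite ltn_neqAle skj andbT; apply/eqP => skE; apply: far_j; rewrite -skE.
  case: j => // j in skj far_j j_min jn skj' *.
  have [a Ea zja] : close (z j).
    apply: contrapT => far; have := j_min j; rewrite ltnn => /(_ _)/negP.
    by apply => //; exact/asboolP.
  exists a => //; rewrite -(subrKA (z j)) (le_lt_trans (ler_normD _ _))// ltrD//.
  by apply: HN1; rewrite (leq_trans N1k)// (leq_trans (s_ge k)).
have [kn Hkn] := choice crossing.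
have [|p pz] := @bounded_frequently_near _ _ (fun N => z (kn N).2) M.
  by move=> N; case: (Hkn N) => _ Ik _ _; exact: IM Ik.
have : seg_limits z I p.
  move=> e' e'0 N; have [n Nn znp] := pz e' e'0 N.
  exists (kn n).1, (kn n).2; split => //; last by case: (Hkn n).
  by case: (Hkn n) => /(leq_trans Nn).
have [N _ zNp] := pz _ e30 0%N.
have [_ _ farN [a Ea zNa]] := Hkn N.
(* A cluster point of the crossings is in neither piece: in [E false] it would make the crossing
   close; in [E true] it would be within 2e/3 + e/3 of [a], against the gap. *)
rewrite LE => -[Ep|Ep].
  by apply: farN; exists p.
have := gap _ _ Ea Ep; apply/negP; rewrite -ltNge.
rewrite -(subrKA (z (kn N).2)) (le_lt_trans (ler_normD _ _))//.
by rewrite -normrN opprB; lra.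
Qed.

Lemma frequently_near_subsequence (R : realType) (V : normedModType R)
    (z : nat -> V) w N : frequently_near z w ->
  exists s : nat -> nat, [/\ forall k, (k <= s k)%N,
    forall k, (N <= s k)%N & (z \o s) @ \oo --> w].
Proof.
move=> /frequently_nearP[s s_incr zsw]; exists (fun k => s (k + N)%N); split.
- by move=> k; rewrite (leq_trans (leq_addr N k)) ?increasing_seq_geq.
- by move=> k; rewrite (leq_trans (leq_addl k N)) ?increasing_seq_geq.
- by move: zsw; rewrite -(cvg_shiftn N).
Qed.

(** Take for segments the whole tails from [s k] on: their upper limit is the full cluster set. *)
Lemma connected_frequently_near (R : realType) m (z : nat -> 'rV[R]_m) (M : R) N :
  `|z n.+1 - z n| @[n --> \oo] --> 0 ->
  (forall n, (N <= n)%N -> `|z n| <= M) ->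
  connected (frequently_near z).
Proof.
move=> step zM.
have [->|/set0P[w zw]] := eqVneq (frequently_near z) set0; first exact: connected0.
have [s [s_ge s_N zsw]] := frequently_near_subsequence N zw.
suff -> : frequently_near z = seg_limits z (fun k => [set n | (s k <= n)%N]).
  apply: (@connected_seg_limits _ _ _ _ s w M) => //= [k n j _ /andP[]//|k n kn].
  by apply: zM; rewrite (leq_trans (s_N k)).
apply/seteqP; split=> [p zp e e0 N1|p Lp e e0 N1].
  by have [n Nn zn] := zp e e0 (s N1); exists N1, n.
have [k [n [Nk /= sn zn]]] := Lp e e0 N1; exists n => //.
by rewrite (leq_trans Nk)// (leq_trans (s_ge k)).
Qed.

(* If the sequence left every ball infinitely often, its excursions from [w]
   would produce a connected set of cluster points reaching outside the
   bounded component of [w] in [K]. *)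
Lemma bounded_of_compact_components (R : realType) m (z : nat -> 'rV[R]_m)
    (K : set 'rV[R]_m) w :
  `|z n.+1 - z n| @[n --> \oo] --> 0 ->
  frequently_near z `<=` K ->
  compact (connected_component K w) ->
  frequently_near z w ->
  exists (M : R) N, forall n, (N <= n)%N -> `|z n| <= M.
Proof.
move=> step zK /compact_bounded[r [_ Cr]] zw.
(* The radius leaves a margin both over [r + 1], which bounds the component, and over [|w| + 1],
   which bounds the late starting points. *)
pose rho := Num.max r `|w| + 2.
have [r_max w_max] : r <= Num.max r `|w| /\ `|w| <= Num.max r `|w|.
  by rewrite !le_max !lexx orbT.
have [r_rho w_rho] : r + 1 < rho /\ `|w| + 1 < rho by rewrite /rho; lra.
apply: contrapT => unbounded.
have exceeds N : exists n, (N <= n)%N && (rho < `|z n|).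
  apply: contrapT => no; apply: unbounded; exists rho, N => n Nn.
  by rewrite leNgt; apply/negP => zn; apply: no; exists n; rewrite Nn.
have [s0 [s0_ge _ zs0]] := frequently_near_subsequence 0 zw.
have [N0 _ HN0] : \forall k \near \oo, `|z (s0 k)| <= rho.
  move/cvgrPdist_lt : zs0 => /(_ 1 ltr01); apply: filterS => k /= wz.
  have : `|z (s0 k)| <= `|z (s0 k) - w| + `|w|.
    by rewrite -[in leLHS](subrK w (z _)) ler_normD.
  by rewrite distrC; lra.
(* Dropping the first [N0] terms makes every segment start inside the ball of radius [rho]. *)
pose s k := s0 (k + N0)%N.
have s_ge k : (k <= s k)%N by rewrite (leq_trans (leq_addr N0 k))// s0_ge.
have zsw : (z \o s) @ \oo --> w by move: zs0; rewrite -(cvg_shiftn N0).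
have zs k : `|z (s k)| <= rho by apply: HN0; exact: leq_addl.
(* The run of the orbit from [s k] until it first leaves the ball. *)
pose I k := [set n | (s k <= n)%N /\ forall j, (s k <= j <= n)%N -> `|z j| <= rho].
have IM k n : I k n -> `|z n| <= rho by case=> sn; apply; rewrite sn leqnn.
have Lconn : connected (seg_limits z I).
  apply: (@connected_seg_limits _ _ _ _ s w rho) => //.
  - by move=> k; split=> // j; rewrite -eqn_leq => /eqP <-.
  - by move=> k n [].
  - move=> k n j [sn H] /andP[sj jn]; split => // i /andP[si ij].
    by apply: H; rewrite si (leq_trans ij).
have Lw : seg_limits z I w.
  move=> e e0 N; move/cvgrPdist_lt : zsw => /(_ e e0)[N1 _ HN1].
  exists (maxn N N1), (s (maxn N N1)); split; first exact: leq_maxl.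
    by split=> // j; rewrite -eqn_leq => /eqP <-.
  by rewrite distrC; apply: HN1; exact: leq_maxr.
have LK : seg_limits z I `<=` K.
  move=> p Lp; apply: zK => e e0 N.
  have [k [n [Nk [sn _] zn]]] := Lp e e0 N; exists n => //.
  by rewrite (leq_trans Nk)// (leq_trans (s_ge k)).
(* The limit set is connected, contains [w] and lies in [K], so it stays in the component of [w]. *)
have Lr p : seg_limits z I p -> `|p| <= r + 1.
  move=> Lp; apply: (Cr (r + 1)); first by rewrite ltrDl.
  exact: (connected_component_max Lw LK).
(* Each run ends just before the first index beyond [s k] where the norm exceeds [rho]. *)
have exit k : exists n, I k n /\ rho < `|z n.+1|.
  case: (ex_minnP (exceeds (s k))) => -[|j] /andP[sj zj] j_min.
    by move: (zs k); rewrite leNgt (_ : s k = 0)%N ?zj//; apply/eqP; rewrite -leqn0.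
  have sj' : (s k <= j)%N.
    rewrite -ltnS ltn_neqAle sj andbT; apply/eqP => skE.
    by move: (zs k); rewrite skE leNgt zj.
  exists j; split => //; split => // i /andP[si ij]; rewrite leNgt; apply/negP => zi.
  by have := j_min i; rewrite si zi => /(_ isT); rewrite leqNgt ltnS ij.
have [t Ht] := choice exit.
have [p tp] : exists p, frequently_near (z \o t) p.
  by apply: (@bounded_frequently_near _ _ _ rho) => k; case: (Ht k) => /IM.
have Lp : seg_limits z I p.
  move=> e e0 N; have [k Nk zk] := tp e e0 N.
  by exists k, (t k); split => //; case: (Ht k).
(* Half of the margin: a point this near [p], moved by a step this small, still has norm below
   [rho], so it cannot have been leaving the ball. *)
have e0 : 0 < (rho - (r + 1)) / 2 by rewrite divr_gt0// subr_gt0.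
move/cvgrPdist_lt : step => /(_ _ e0)[N _ HN].
have [k Nk /= ztp] := tp _ e0 N.
have zt1 : `|z (t k).+1 - z (t k)| < (rho - (r + 1)) / 2.
  have /= := HN (t k); rewrite sub0r normrN normr_id; apply.
  case: (Ht k) => -[st _] _.
  by rewrite (leq_trans Nk)// (leq_trans (s_ge k)).
have [_ zr] := Ht k; have pr := Lr _ Lp.
have : `|z (t k).+1| <= `|z (t k).+1 - z (t k)| + `|z (t k) - p| + `|p|.
  rewrite -[in leLHS](subrK p (z _)) (le_trans (ler_normD _ _))// lerD2r.
  by rewrite -(subrKA (z (t k))) ler_normD.
lra.
Qed.

(* The distance to a point maps a connected set to an interval, which must be
   Lebesgue-null, hence trivial, if the set is countable. *)
Lemma countable_connected_set1 (R : realType) (V : normedModType R)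
    (A : set V) (w : V) :
  countable A -> connected A -> A w -> A = [set w].
Proof.
move=> cA connA Aw; apply/seteqP; split=> [v Av|_ ->//] /=.
apply: contrapT => /eqP vw.
pose g (x : V) := `|x - w|.
have g_cont : continuous g.
  move=> x; apply: (@continuous_comp _ _ _ (fun x => x - w) (fun x => `|x|)).
    by apply: cvgB; [exact: cvg_id|exact: cvg_cst].
  exact: norm_continuous.
have /connected_intervalP gA : connected (g @` A).
  apply: connected_continuous_connected => //.
  exact: continuous_subspaceT.
have cgA : countable (g @` A) by exact: sub_countable (card_image_le _ _) cA.
have gv0 : 0 < g v by rewrite normr_gt0 subr_eq0.
have sub : `[0, g v] `<=` g @` A.
  move=> x /=; rewrite in_itv /= => x0v; apply: gA x0v; last by exists v.
  by exists w => //; rewrite /g subrr normr0.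
have := countable_lebesgue_measure0 (sub_countable (subset_card_le sub) cgA).
rewrite lebesgue_measure_itv /= lte_fin gv0 oppr0 adde0 => -[] gv.
by move: gv0; rewrite gv ltxx.
Qed.

(** Otherwise infinitely many terms stay at distance at least [e] from [w], and by boundedness they
    have a cluster point other than [w]. *)
Lemma cvg_of_unique_limit (R : realType) m (z : nat -> 'rV[R]_m) (M : R) N w :
  (forall n, (N <= n)%N -> `|z n| <= M) ->
  frequently_near z `<=` [set w] -> z @ \oo --> w.
Proof.
move=> zM zw; apply/cvgrPdist_lt => e e0; apply: contrapT => far.
(* The index bound [k + N] serves twice: above [N] the terms are bounded, and above [k] cluster
   points of the selection are cluster points of [z]. *)
have far_n k : exists n, (k + N <= n)%N /\ e <= `|z n - w|.
  apply: contrapT => no; apply: far; exists (k + N)%N => // n /= Nn.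
  by rewrite distrC ltNge; apply/negP => zn; apply: no; exists n.
have [t Ht] := choice far_n.
have [p tp] : exists p, frequently_near (z \o t) p.
  apply: (@bounded_frequently_near _ _ _ M) => k; apply: zM.
  by case: (Ht k) => /(leq_trans (leq_addl _ _)).
have pw : p = w.
  apply: zw => e' e'0 N'; have [k Nk zk] := tp e' e'0 N'; exists (t k) => //.
  by case: (Ht k) => /(leq_trans (leq_addr _ _)) /(leq_trans Nk).
have [k _] := tp e e0 0%N; rewrite pw; apply/negP; rewrite -leNgt.
by case: (Ht k).
Qed.

(** * Euclidean norm, gradient and Armijo's condition *)

Lemma enorm_sqr (R : realType) m (v : 'rV[R]_m) :
  enorm v ^+ 2 = \sum_(i < m) v 0 i ^+ 2.
Proof. by rewrite sqr_sqrtr// sumr_ge0// => i _; exact: sqr_ge0. Qed.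

Lemma norm_le_enorm (R : realType) m (v : 'rV[R]_m) : `|v| <= enorm v.
Proof.
rewrite [leLHS]/Num.norm /= mx_normrE; apply/bigmax_leP; split => [|[i j] _ /=].
  exact: sqrtr_ge0.
rewrite ord1 -sqrtr_sqr ler_wsqrtr// (bigD1 j)//= lerDl sumr_ge0// => k _.
exact: sqr_ge0.
Qed.

Lemma enorm_continuous (R : realType) m : continuous (@enorm R m).
Proof.
move=> v; apply: (@continuous_comp _ _ _ _ (@Num.sqrt R)); last first.
  exact: sqrt_continuous.
apply: continuous_big => [|i _ {}v]; first exact: add_continuous.
apply: (@continuous_comp _ _ _ (fun x : 'rV[R]_m => x 0 i) (fun y => y ^+ 2)).
  exact: coord_continuous.
exact: exprn_continuous.
Qed.

Lemma derive_gradient (R : realType) m (h : 'rV[R]_m -> R) (w v : 'rV[R]_m) :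
  differentiable h w -> 'D_v h w = \sum_(i < m) v 0 i * gradient h w 0 i.
Proof.
move=> dh; rewrite deriveE// [in LHS](row_sum_delta v) linear_sum /=.
by apply: eq_bigr => i _; rewrite linearZ /= mxE deriveE.
Qed.

(** The one-variable mean value theorem applied along the ray [w - t *: v]. *)
Lemma gradient_MVT (R : realType) m (h : 'rV[R]_m -> R) (w v : 'rV[R]_m)
    (delta : R) :
  (forall x, differentiable h x) -> 0 < delta ->
  exists2 t : R, 0 < t < delta & h (w - delta *: v) - h w =
    - delta * \sum_(i < m) v 0 i * gradient h (w - t *: v) 0 i.
Proof.
move=> dh delta0; pose phi (t : R) := h (w - t *: v).
have dphi (t : R) : is_derive t 1 phi ('D_(- v) h (w - t *: v)).
  (* The difference quotient of [phi] at [t] is that of [h] in direction [- v]. *)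
  have shiftE : (fun x : R => x^-1 *: ((phi \o shift t) (x *: 1) - phi t)) =
    (fun x : R => x^-1 *: ((h \o shift (w - t *: v)) (x *: - v)
                           - h (w - t *: v))).
    apply/funext => x; rewrite /phi /=; congr (_ *: (h _ - _)).
    by rewrite [x%:A]mulr1 scalerDl scalerN opprD addrCA.
  split; last by rewrite /derive shiftE.
  by rewrite /derivable shiftE; exact: diff_derivable.
have [|t t_in] := @MVT _ phi _ 0 delta delta0 (fun t _ => dphi t).
  apply: continuous_subspaceT => t; apply: differentiable_continuous.
  by apply/derivable1_diffP; case: (dphi t).
rewrite /phi scale0r subr0 derive_gradient// subr0 => ->.
exists t; first by move: t_in; rewrite in_itv.
rewrite mulrC mulNr -mulrN -sumrN; congr (_ * _).
by apply: eq_bigr => i _; rewrite mxE mulNr.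
Qed.

Lemma gradient_step_continuous (R : realType) m (g : 'rV[R]_m -> 'rV[R]_m)
    (p : 'rV[R]_m) (t : R) : continuous g ->
  {for (p, t), continuous (fun x : 'rV[R]_m * R => g (x.1 - x.2 *: g x.1))}.
Proof.
move=> cg.
apply: (@continuous_comp _ _ _ (fun x : 'rV[R]_m * R => x.1 - x.2 *: g x.1) g);
  last exact: cg.
apply: cvgB; first exact: cvg_fst.
apply: cvgZ; first exact: cvg_snd.
by apply: continuous_comp; [exact: cvg_fst|exact: cg].
Qed.

(** By the mean value theorem, Armijo's condition at [w] follows from [0 < G (w, t)] for an
    intermediate [t]. At [(p, 0)], [G] equals (1 - alpha) times the squared gradient norm, and joint
    continuity makes one [d] serve all nearby [w]. *)
Lemma armijo_near (R : realType) m (h : 'rV[R]_m -> R) (p : 'rV[R]_m)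
    (alpha : R) :
  C1 h -> alpha < 1 -> gradient h p != 0 ->
  exists2 d : R, 0 < d & forall w, `|w - p| < d ->
    forall delta, 0 < delta -> delta < d -> armijo alpha h w delta.
Proof.
move=> [dh ch] alpha1 gp0.
pose G (x : 'rV[R]_m * R) := \sum_(i < m)
  (gradient h x.1 0 i * gradient h (x.1 - x.2 *: gradient h x.1) 0 i
   - alpha * gradient h x.1 0 i ^+ 2).
have G_cont : {for (p, 0), continuous G}.
  apply: cvg_big => [|i _]; first exact: add_continuous.
  have c1 : {for (p, 0), continuous (fun x : 'rV[R]_m * R => gradient h x.1 0 i)}.
    apply: (@continuous_comp _ _ _ fst (fun w => gradient h w 0 i)).
      exact: cvg_fst.
    exact: (continuous_comp (ch p) (@coord_continuous _ _ _ _ _ _)).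
  have c2 : {for (p, 0), continuous (fun x : 'rV[R]_m * R =>
      gradient h (x.1 - x.2 *: gradient h x.1) 0 i)}.
    apply: (@continuous_comp _ _ _ _ (fun M : 'rV[R]_m => M 0 i)).
      exact: gradient_step_continuous.
    exact: coord_continuous.
  apply: cvgB; first exact: cvgM c1 c2.
  apply: cvgM; first exact: cvg_cst.
  exact: (continuous_comp c1 (@exprn_continuous _ _ _)).
have Gp : 0 < G (p, 0).
  rewrite /G /= scale0r subr0.
  under eq_bigr do rewrite -expr2 -[X in X - _]mul1r -mulrBl.
  rewrite -mulr_sumr mulr_gt0 ?subr_gt0// -enorm_sqr exprn_gt0//.
  by rewrite (lt_le_trans _ (norm_le_enorm _))// normr_gt0.
have /nbhs_ballP[d /= d0 dG] : nbhs (p, 0 : R) [set x | 0 < G x].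
  exact: (cvgr_gt _ G_cont).
exists d => // w wp delta delta0 deltad.
have [t /andP[t0 t_delta] hE] := gradient_MVT w (gradient h w) dh delta0.
have : 0 < G (w, t).
  apply: dG; split; rewrite -ball_normE /=; first by rewrite distrC.
  by rewrite sub0r normrN gtr0_norm// (lt_trans t_delta).
rewrite /G /= sumrB -mulr_sumr -enorm_sqr subr_gt0 => Gwt.
by rewrite /armijo hE mulrAC !mulNr lerN2 mulrC ler_wpM2l// ltW.
Qed.

(** * Chain rule for affine substitutions *)

Lemma mulmxr_continuous (R : realType) k m (A : 'M[R]_(k, m)) :
  continuous (fun x : 'rV[R]_k => x *m A).
Proof.
under [fun x => _]funext => x do rewrite mulmx_sum_row.
apply: continuous_big => [|i _ x]; first exact: add_continuous.
apply: (@cvgZr_tmp _ _ _ (nbhs (x : 'rV[R]_k))).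
exact: coord_continuous.
Qed.

Section affine_chain_rule.
Variables (R : realType) (k m : nat) (f : 'rV[R]_m -> R) (h : 'rV[R]_k -> R).
Variables (A : 'M[R]_(k, m)) (b : 'rV[R]_m) (c : R).
Hypothesis f_C1 : C1 f.
Hypothesis hE : forall x, h x = f (x *m A + b) + c.

(** The difference quotient of [h] along a basis vector is that of [f] along its image under [A];
    the constants cancel. *)
Lemma gradient_affine x : gradient h x = gradient f (x *m A + b) *m A^T.
Proof.
apply/rowP => i; rewrite !mxE.
have -> : 'D_(delta_mx 0 i) h x = 'D_(delta_mx 0 i *m A) f (x *m A + b).
  rewrite /derive; set d1 := (fun _ => _); set d2 := (fun _ => _).
  suff -> : d1 = d2 by [].
  apply/funext => t; rewrite /d1 /d2 /= !hE mulmxDl -scalemxAl.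
  by rewrite opprD addrACA subrr addr0 addrA.
rewrite derive_gradient; last exact: f_C1.1.
by apply: eq_bigr => j _; rewrite -rowE !mxE mulrC.
Qed.

Lemma C1_affine : C1 h.
Proof.
have lin_cont : continuous (fun x : 'rV[R]_k => x *m A + b).
  move=> x; apply: (@cvgD _ _ _ (nbhs (x : 'rV[R]_k))); last exact: cvg_cst.
  exact: mulmxr_continuous.
split.
  move=> x; rewrite (_ : h = (fun y => f (mulmxr A y + b) + c)); last first.
    by apply/funext => y; rewrite hE.
  apply: differentiableD => //.
  apply: (@differentiable_comp _ _ _ _ (fun y => mulmxr A y + b) f).
    apply: differentiableD => //; apply: linear_differentiable.
    exact: mulmxr_continuous.
  exact: f_C1.1.
rewrite (_ : gradient h = (fun x => gradient f (x *m A + b) *m A^T)); last first.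
  exact/funext/gradient_affine.
move=> x; apply: (@continuous_comp _ _ _
  (fun x : 'rV[R]_k => gradient f (x *m A + b))
  (fun M : 'rV[R]_m => M *m A^T)); last exact: mulmxr_continuous.
apply: (@continuous_comp _ _ _ (fun x : 'rV[R]_k => x *m A + b) (gradient f)).
  exact: lin_cont.
exact: f_C1.2.
Qed.

End affine_chain_rule.

(** * Backtracking descent for a single function *)

Section backtracking.
Variables (R : realType) (m : nat) (h : 'rV[R]_m -> R).
Variables (alpha beta delta0 : R).
Hypothesis h_C1 : C1 h.
Hypothesis alpha_itv : 0 < alpha < 1.
Hypothesis beta_itv : 0 < beta < 1.
Hypothesis delta0_gt0 : 0 < delta0.

Local Notation step := (backtracking_step alpha beta delta0 h).
Local Notation steps := (armijo_steps alpha beta delta0 h).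

Let beta_gt0 : 0 < beta. Proof. by case/andP: beta_itv. Qed.
Let alpha_gt0 : 0 < alpha. Proof. by case/andP: alpha_itv. Qed.
Let pow_gt0 n : 0 < beta ^+ n * delta0.
Proof. by rewrite mulr_gt0// exprn_gt0. Qed.

Lemma small_power (d : R) : 0 < d -> exists n, beta ^+ n * delta0 < d.
Proof.
move=> d0; have /cvgrPdist_lt/(_ (d / delta0)) : beta ^+ n @[n --> \oo] --> 0.
  by apply: cvg_expr; rewrite gtr0_norm//; case/andP: beta_itv.
rewrite divr_gt0// => /(_ isT)[n _ /(_ n (leqnn n)) /=].
by rewrite sub0r normrN gtr0_norm ?exprn_gt0// ltr_pdivlMr//; exists n.
Qed.

(** At a critical point both sides of Armijo's condition vanish, so [delta0] qualifies; elsewhere a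
    small enough power does. *)
Lemma armijo_steps_nonempty w : steps w !=set0.
Proof.
have [gw0|gw0] := eqVneq (gradient h w) 0.
  exists delta0; split; first by exists 0%N; rewrite mul1r.
  by rewrite /armijo enorm_sqr gw0 scaler0 subr0 subrr big1 ?mulr0// => i _;
    rewrite mxE expr0n.
have [|d d0 Hd] := armijo_near (alpha := alpha) h_C1 _ gw0.
  by case/andP: alpha_itv.
have [n nd] := small_power d0.
exists (beta ^+ n * delta0); split; first by exists n.
by apply: Hd => //; rewrite subrr normr0.
Qed.

(** The least admissible exponent gives the largest step since [beta] < 1, so the default value of
    [xget] never occurs. *)
Lemma backtracking_stepP w : (steps w `&` ubound (steps w)) (step w).
Proof.
apply: xgetPex; have [delta [[n ->] an]] := armijo_steps_nonempty w.
have ex : exists n, `[< armijo alpha h w (beta ^+ n * delta0) >].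
  by exists n; apply/asboolP.
case: (ex_minnP ex) => j /asboolP aj j_min.
exists (beta ^+ j * delta0); split; first by split; first by exists j.
move=> _ [[i ->] ai]; rewrite ler_pM2r// ler_wiXn2l ?(ltW beta_gt0)//.
  by case/andP: beta_itv => _ /ltW.
by apply: j_min; exact/asboolP.
Qed.

Lemma backtracking_step_gt0 w : 0 < step w.
Proof. by have [[[n ->] _] _] := backtracking_stepP w. Qed.

Lemma backtracking_step_le w : step w <= delta0.
Proof.
have [[[n ->] _] _] := backtracking_stepP w.
by rewrite ler_piMl ?(ltW delta0_gt0)// exprn_ile1 ?(ltW beta_gt0)//;
  case/andP: beta_itv => _ /ltW.
Qed.

(** One fixed power is admissible at all points near [p], and the chosen step is at least any
    admissible one. *)
Lemma backtracking_step_ge_near p : gradient h p != 0 ->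
  exists c d : R, [/\ 0 < c, 0 < d & forall w, `|w - p| < d -> c <= step w].
Proof.
move=> gp0; have [|d d0 Hd] := armijo_near (alpha := alpha) h_C1 _ gp0.
  by case/andP: alpha_itv.
have [n nd] := small_power d0.
exists (beta ^+ n * delta0), d; split => // w wp.
have [_] := backtracking_stepP w; apply; split; first by exists n.
exact: Hd.
Qed.

Variable x0 : 'rV[R]_m.
Let x n := iter n (backtracking_update alpha beta delta0 h) x0.
Let decr n := step (x n) * enorm (gradient h (x n)) ^+ 2.

Lemma backtracking_descent n : h (x n.+1) <= h (x n) - alpha * decr n.
Proof.
have [[_ armijo_xn] _] := backtracking_stepP (x n).
by rewrite -lerBlDl /decr mulrA -!mulNr; exact: armijo_xn.
Qed.

(** The values of [h] decrease along the orbit and return arbitrarily near [h p], so they decrease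
    to [h p]; [alpha * decr n] is at most the drop at step [n]. *)
Lemma backtracking_decrement_cvg0 p : frequently_near x p ->
  decr n @[n --> \oo] --> 0.
Proof.
move=> xp.
have decr_ge0 n : 0 <= decr n.
  by rewrite mulr_ge0 ?sqr_ge0// ltW// backtracking_step_gt0.
have h_noninc : nonincreasing_seq (h \o x).
  apply/nonincreasing_seqP => n /=; rewrite (le_trans (backtracking_descent n))//.
  by rewrite gerBl mulr_ge0// ltW.
have h_near (e : R) N : 0 < e -> exists2 n, (N <= n)%N & `|h (x n) - h p| < e.
  move=> e0; have : {for p, continuous h}.
    exact/differentiable_continuous/h_C1.1.
  move=> /cvgrPdist_lt/(_ e e0)/nbhs_ballP[d /= d0 dh].
  have [n Nn xnp] := xp d d0 N; exists n => //; rewrite distrC; apply: dh.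
  by rewrite -ball_normE /= distrC.
have h_ge n : h p <= h (x n).
  apply/ler_addgt0Pr => e e0; have [j nj] := h_near e n e0.
  rewrite ltr_distl => /andP[lb _]; have /= := h_noninc _ _ nj; lra.
apply/cvgrPdist_lt => e e0.
have [N _] := h_near (alpha * e) 0%N (mulr_gt0 alpha_gt0 e0).
rewrite ltr_distl => /andP[_ ub].
exists N => // n /= Nn; rewrite sub0r normrN ger0_norm// -(ltr_pM2l alpha_gt0).
have := backtracking_descent n; have := h_ge n.+1.
have /= := h_noninc _ _ Nn; lra.
Qed.

(** The squared increment is at most step^2 |grad|^2, hence at most [delta0 * decr n]. *)
Lemma backtracking_increment_cvg0 p : frequently_near x p ->
  `|x n.+1 - x n| @[n --> \oo] --> 0.
Proof.
move=> /backtracking_decrement_cvg0/cvgrPdist_lt decr0.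
apply/cvgrPdist_lt => e e0.
have : 0 < e ^+ 2 / delta0 by rewrite divr_gt0// exprn_gt0.
move=> /decr0; apply: filterS => n /=; rewrite !sub0r !normrN normr_id.
move=> /(le_lt_trans (ler_norm _)); rewrite ltr_pdivlMr// => decr_lt.
rewrite -(@ltr_pXn2r _ 2) ?nnegrE ?(ltW e0)//; apply: le_lt_trans decr_lt.
rewrite /x /= -/(x n) /backtracking_update addrC addKr normrN normrZ exprMn.
rewrite gtr0_norm ?backtracking_step_gt0// /decr expr2 -mulrA [leRHS]mulrAC.
rewrite -[leRHS]mulrA ler_pM2l ?backtracking_step_gt0//.
apply: ler_pM => //; first exact/ltW/backtracking_step_gt0.
- exact: backtracking_step_le.
- by rewrite ler_sqr ?nnegrE ?norm_le_enorm// (le_trans _ (norm_le_enorm _)).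
Qed.

(** Near a noncritical [p] the step is at least [c] and the gradient norm at least half its value at
    [p], so [decr n] would be at least [c * r ^+ 2] infinitely often. *)
Lemma backtracking_critical p : frequently_near x p -> gradient h p = 0.
Proof.
move=> xp; apply: contrapT => /eqP gp0.
have [c [d [c0 d0 Hd]]] := backtracking_step_ge_near gp0.
pose r := `|gradient h p| / 2.
have r0 : 0 < r by rewrite divr_gt0// normr_gt0.
have /cvgrPdist_lt/(_ r r0)/nbhs_ballP[d' /= d'0 Hd'] := h_C1.2 p.
have : 0 < c * r ^+ 2 by rewrite mulr_gt0// exprn_gt0.
move/cvgrPdist_lt: (backtracking_decrement_cvg0 xp) => /[apply] -[N _ HN].
have dd'0 : 0 < Num.min d d' by rewrite lt_min d0.
have [n Nn] := xp _ dd'0 N; rewrite lt_min => /andP[xd xd'].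
have := HN n Nn; rewrite /= sub0r normrN => /(le_lt_trans (ler_norm _)).
apply/negP; rewrite -leNgt; apply: ler_pM; rewrite ?sqr_ge0 ?(ltW c0)//.
  exact: Hd.
have rg : r <= enorm (gradient h (x n)).
  apply: le_trans (norm_le_enorm _).
  have : `|gradient h p - gradient h (x n)| < r.
    by apply: Hd'; rewrite -ball_normE /= distrC.
  have : `|gradient h p| <= `|gradient h p - gradient h (x n)| + `|gradient h (x n)|.
    by rewrite -[in leLHS](subrK (gradient h (x n)) (gradient h p)) ler_normD.
  by rewrite /r; lra.
by rewrite ler_sqr ?nnegrE ?(le_trans _ rg)// ltW.
Qed.

End backtracking.

(** * Separable functions and the product sequence *)

Lemma norm_row_mx_le (R : realType) m1 m2 (a : 'rV[R]_m1) (b : 'rV[R]_m2) :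
  `|row_mx a b| <= `|a| + `|b|.
Proof.
have entry_le m (v : 'rV[R]_m) i j : `|v i j| <= `|v|.
  rewrite [leRHS]/Num.norm /= mx_normrE; apply/bigmax_geP; right.
  by exists (i, j).
rewrite [leLHS]/Num.norm /= mx_normrE; apply/bigmax_leP; split => [|[i j] _ /=].
  exact: addr_ge0.
case: (splitP j) => k jk.
  have -> : j = lshift m2 k by exact: val_inj.
  by rewrite row_mxEl (le_trans (entry_le _ _ _ _))// lerDl.
have -> : j = rshift m1 k by exact: val_inj.
by rewrite row_mxEr (le_trans (entry_le _ _ _ _))// lerDr.
Qed.

Lemma frequently_near_continuous (R : realType) (V W : normedModType R)
    (g : V -> W) (u : nat -> V) p :
  {for p, continuous g} -> frequently_near u p -> frequently_near (g \o u) (g p).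
Proof.
move=> gp up e e0 N; have /cvgrPdist_lt/(_ e e0)/nbhs_ballP[d /= d0 dg] := gp.
have [n Nn und] := up d d0 N; exists n => //; rewrite distrC; apply: dg.
by rewrite -ball_normE /= distrC.
Qed.

(** If the norms do not tend to infinity, infinitely many terms lie in one ball and accumulate
    there. *)
Lemma cvgy_or_frequently_near (R : realType) m (z : nat -> 'rV[R]_m) :
  enorm (z n) @[n --> \oo] --> +oo \/ exists p, frequently_near z p.
Proof.
have [?|not_oo] := pselect (enorm (z n) @[n --> \oo] --> +oo); first by left.
right; have [A nA] : exists A, ~ \forall n \near \oo, A <= enorm (z n).
  apply: contrapT => all_A; apply/not_oo/cvgryPge => A.
  by apply: contrapT => nA; apply: all_A; exists A.
have below N : exists n, (N <= n)%N /\ enorm (z n) <= A.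
  apply: contrapT => no; apply: nA; exists N => // n /= Nn.
  by rewrite leNgt; apply/negP => zn; apply: no; exists n; rewrite ltW.
have [t Ht] := choice below.
have [p tp] : exists p, frequently_near (z \o t) p.
  apply: (@bounded_frequently_near _ _ _ A) => k.
  by rewrite (le_trans (norm_le_enorm _))//; case: (Ht k).
exists p => e e0 N; have [n Nn zn] := tp e e0 N; exists (t n) => //.
by case: (Ht n) => /(leq_trans Nn).
Qed.

Section separable.
Variables (R : realType) (m1 m2 : nat) (f : 'rV[R]_(m1 + m2) -> R).
Variables (f1 : 'rV[R]_m1 -> R) (f2 : 'rV[R]_m2 -> R).
Hypothesis f_C1 : C1 f.
Hypothesis fE : forall x y, f (row_mx x y) = f1 x + f2 y.

(** Up to a constant, [f1] is [f] on the affine slice with [y] fixed; this is the form the affine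
    chain rule takes. *)
Let f1E y x : f1 x = f (x *m row_mx 1%:M 0 + row_mx 0 y) + (- f2 y).
Proof. by rewrite mul_mx_row mulmx1 mulmx0 add_row_mx addr0 add0r fE addrK. Qed.

Let f2E x y : f2 y = f (y *m row_mx 0 1%:M + row_mx x 0) + (- f1 x).
Proof.
by rewrite mul_mx_row mulmx1 mulmx0 add_row_mx addr0 add0r fE addrAC subrr add0r.
Qed.

Lemma C1_separable : C1 f1 /\ C1 f2.
Proof. by split; [exact: C1_affine f_C1 (f1E 0)|exact: C1_affine f_C1 (f2E 0)]. Qed.

Lemma gradient_separable x y :
  gradient f (row_mx x y) = row_mx (gradient f1 x) (gradient f2 y).
Proof.
rewrite (gradient_affine f_C1 (f1E y)) (gradient_affine f_C1 (f2E x)).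
rewrite !mul_mx_row !mulmx1 !mulmx0 !add_row_mx !addr0 !add0r.
rewrite !tr_row_mx !trmx1 !trmx0.
rewrite -[gradient f _]hsubmxK !mul_row_col !mulmx1 !mulmx0.
by rewrite addr0 add0r.
Qed.

End separable.

Theorem theorem0p3 (R : realType) (m1 m2 : nat)
    (f : 'rV[R]_(m1 + m2) -> R)
    (f1 : 'rV[R]_m1 -> R) (f2 : 'rV[R]_m2 -> R)
    (hfC1 : C1 f)
    (hf : forall (x : 'rV[R]_m1) (y : 'rV[R]_m2),
        f (row_mx x y) = f1 x + f2 y)
    (alpha beta delta0 : R)
    (halpha : 0 < alpha < 1) (hbeta : 0 < beta < 1) (hdelta0 : 0 < delta0)
    (x0 : 'rV[R]_m1) (y0 : 'rV[R]_m2) :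
  let z := coordwise_backtracking_GD alpha beta delta0 f1 f2 x0 y0 in
  [/\ cluster_points z `<=` critical_points f,
      enorm (z n) @[n --> \oo] --> +oo \/
        enorm (z n.+1 - z n) @[n --> \oo] --> 0,
      countable (critical_points f) ->
        (exists2 zinf : 'rV[R]_(m1 + m2),
            z @ \oo --> zinf & gradient f zinf = 0) \/
        enorm (z n) @[n --> \oo] --> +oo
    & (forall w : 'rV[R]_(m1 + m2), critical_points f w ->
          compact (connected_component (critical_points f) w)) ->
        connected (cluster_points z)].
Proof.
move=> z.
have -> : cluster_points z = frequently_near z.
  by apply/seteqP; split => p /frequently_nearP.
have [f1_C1 f2_C1] := C1_separable hfC1 hf.
pose x n := iter n (backtracking_update alpha beta delta0 f1) x0.
pose y n := iter n (backtracking_update alpha beta delta0 f2) y0.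
(* A cluster point of [z] projects to cluster points of both coordinates, so the single-function
   results apply to each. *)
have zx p : frequently_near z p -> frequently_near x (lsubmx p).
  move=> zp; rewrite (_ : x = lsubmx \o z).
    by apply: frequently_near_continuous zp; exact: continuous_lsubmx.
  by apply/funext => n /=; rewrite row_mxKl.
have zy p : frequently_near z p -> frequently_near y (rsubmx p).
  move=> zp; rewrite (_ : y = rsubmx \o z).
    by apply: frequently_near_continuous zp; exact: continuous_rsubmx.
  by apply/funext => n /=; rewrite row_mxKr.
have z_crit : frequently_near z `<=` critical_points f.
  move=> p zp; rewrite /critical_points /= -[p]hsubmxK.
  rewrite (gradient_separable hfC1 hf).
  rewrite (backtracking_critical f1_C1 halpha hbeta hdelta0 (zx _ zp)).
  rewrite (backtracking_critical f2_C1 halpha hbeta hdelta0 (zy _ zp)).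
  exact: row_mx0.
have z_step p : frequently_near z p -> `|z n.+1 - z n| @[n --> \oo] --> 0.
  move=> zp.
  have x_step := backtracking_increment_cvg0 f1_C1 halpha hbeta hdelta0 (zx _ zp).
  have y_step := backtracking_increment_cvg0 f2_C1 halpha hbeta hdelta0 (zy _ zp).
  apply: (@squeeze_cvgr _ _ _ _ (cst 0)
    (fun n => `|x n.+1 - x n| + `|y n.+1 - y n|)).
  - apply: nearW => n; rewrite /= normr_ge0 /=.
    have -> : z n.+1 - z n = row_mx (x n.+1 - x n) (y n.+1 - y n).
      by rewrite opp_row_mx add_row_mx.
    exact: norm_row_mx_le.
  - exact: cvg_cst.
  - by rewrite -[X in _ --> X](addr0 0); exact: cvgD x_step y_step.
have z_bounded p : frequently_near z p ->
    compact (connected_component (critical_points f) p) ->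
    exists (M : R) N, forall n, (N <= n)%N -> `|z n| <= M.
  move=> zp cp.
  exact: (bounded_of_compact_components (z_step _ zp) z_crit cp zp).
split => //.
- have [|[p zp]] := cvgy_or_frequently_near z; first by left.
  right; have /norm_cvg0P dz0 := z_step _ zp.
  have -> : (0 : R) = enorm (0 : 'rV[R]_(m1 + m2)).
    apply/esym/eqP; rewrite -sqrf_eq0 enorm_sqr big1 // => i _.
    by rewrite mxE expr0n.
  exact: cvg_comp dz0 (@enorm_continuous _ _ _).
- move=> crit_countable.
  have [|[p zp]] := cvgy_or_frequently_near z; [by right|left].
  have comp_p : connected_component (critical_points f) p = [set p].
    apply: countable_connected_set1.
    + apply: sub_countable crit_countable; apply: subset_card_le.
      exact: connected_component_sub.
    + exact: component_connected.
    + by apply: connected_component_refl; exact: z_crit.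
  have [|M [N zM]] := z_bounded p zp; first by rewrite comp_p; exact: compact_set1.
  exists p; last exact: z_crit.
  apply: (cvg_of_unique_limit zM).
  (* The cluster set of the bounded orbit is connected and, being made of critical points,
     countable; so it reduces to [p]. *)
  rewrite (@countable_connected_set1 _ _ (frequently_near z) p) //.
  + by apply: sub_countable crit_countable; exact: subset_card_le.
  + exact: connected_frequently_near (z_step _ zp) zM.
- move=> crit_compact.
  have [->|/set0P[p zp]] := eqVneq (frequently_near z) set0; first exact: connected0.
  have [M [N zM]] := z_bounded p zp (crit_compact p (z_crit p zp)).
  exact: connected_frequently_near (z_step _ zp) zM.
Qed.
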